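(* Let $n \geq 2$ be an integer and let $p \in [1,\infty)$. Let $S^{n-1} = \{x \in \mathbb{R}^n : \|x\| = \tfrac{1}{2}\}$ with the Euclidean distance $d(x,y) = \|x-y\|$, let $P(S^{n-1})$ be the set of all Borel probability measures on $S^{n-1}$, and let $W_p$ be the $p$-Wasserstein distance on $P(S^{n-1})$. Let $\phi : P(S^{n-1}) \to P(S^{n-1})$ be a (not necessarily surjective) map satisfying $$W_p(\phi(\mu), \phi(\nu)) = W_p(\mu,\nu) \qquad \text{for all } \mu,\nu \in P(S^{n-1}).$$ Then there exists an isometry $T : S^{n-1} \to S^{n-1}$ (with respect to $d$) such that $$\phi(\delta_x) = T_\# \delta_x, \quad \text{that is,} \quad \phi(\delta_x) = \delta_{T(x)}, \qquad \text{for all } x \in S^{n-1}.$$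
   Context: $\|\cdot\|$ denotes the Euclidean norm on $\mathbb{R}^n$. Note that $S^{n-1}$ here denotes the sphere of radius $1/2$ centered at the origin (so that its diameter is $1$), equipped with the Euclidean (chordal) distance $d(x,y)=\|x-y\|$ inherited from $\mathbb{R}^n$. A coupling of $\mu,\nu \in P(S^{n-1})$ is a Borel probability measure $\pi$ on $S^{n-1}\times S^{n-1}$ with $\pi(A \times S^{n-1}) = \mu(A)$ and $\pi(S^{n-1}\times B) = \nu(B)$ for all Borel sets $A,B \subset S^{n-1}$; $\Pi(\mu,\nu)$ denotes the set of all couplings. The Wasserstein distance of order $p$ is $$W_p(\mu,\nu) = \left(\inf_{\pi \in \Pi(\mu,\nu)} \int_{S^{n-1}\times S^{n-1}} d(x,y)^p \, \mathrm{d}\pi(x,y)\right)^{1/p}.$$ $\delta_x$ denotes the Dirac measure concentrated at $x$. For a measurable map $\psi$, the push-forward $\psi_\#\mu$ is defined by $\psi_\#\mu(B) = \mu(\psi^{-1}(B))$ for measurable sets $B$. An isometry $T$ is a distance-preserving map: $d(T(x),T(y)) = d(x,y)$ for all $x,y \in S^{n-1}$. *)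

(* Defs.v *)
(* MathComp-Analysis; [R : realType] is the field of real numbers. *)
From HB Require Import structures.
From mathcomp Require Import all_boot all_order all_algebra.
From mathcomp Require Import all_classical all_reals all_analysis.

Set Implicit Arguments.
Unset Strict Implicit.
Unset Printing Implicit Defensive.

Import Order.TTheory GRing.Theory Num.Theory.
Import numFieldNormedType.Exports.

Local Open Scope classical_set_scope.
Local Open Scope ring_scope.

(* The library's norm [`|v|] on row vectors is the sup norm. *)
Definition enorm (R : realType) (n : nat) (v : 'rV[R]_n) : R :=
  Num.sqrt (\sum_i v ord0 i ^+ 2).

Definition half_sphere (R : realType) (m : nat) : set 'rV[R]_m.+1 :=
  [set v | enorm v = 2^-1].
Arguments half_sphere R m : clear implicits.

(* The [m]-dimensional sphere of radius 1/2 in [R^(m+1)], so that S^(n-1) is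
   [sphere R n.-1] for [0 < n].  Dimension [m.+1] makes it nonempty, which the
   library requires of a [measurableType].  Its topology is the subspace
   topology of [R^(m+1)]. *)
Definition sphere (R : realType) (m : nat) : Type := set_type (half_sphere R m).

Definition sphere_val (R : realType) (m : nat) (x : sphere R m) : 'rV[R]_m.+1 :=
  set_val x.

Lemma pole_subproof (R : realType) (m : nat) :
  (2^-1 *: delta_mx ord0 ord0 : 'rV[R]_m.+1) \in half_sphere R m.
Proof.
rewrite inE /half_sphere /= /enorm (bigD1 ord0) //= big1 ?addr0; last first.
  by move=> i i0; rewrite !mxE (negbTE i0) mulr0 expr0n.
by rewrite !mxE !eqxx mulr1 sqrtr_sqr ger0_norm ?invr_ge0.
Qed.

Definition pole (R : realType) (m : nat) : sphere R m :=
  SigSub (pole_subproof R m).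

HB.instance Definition _ (R : realType) (m : nat) :=
  Topological.copy (sphere R m) (set_type (half_sphere R m)).
HB.instance Definition _ (R : realType) (m : nat) :=
  isPointed.Build (sphere R m) (pole R m).
HB.instance Definition _ (R : realType) (m : nat) :=
  Measurable.copy (sphere R m)
    (g_sigma_algebraType (@open (sphere R m))).

Section sphere.
Variables (R : realType) (m : nat).
Local Notation S := (sphere R m).

Definition sphere_dist (x y : S) : R := enorm (sphere_val x - sphere_val y).

Definition sphere_isometry (T : S -> S) : Prop :=
  forall x y, sphere_dist (T x) (T y) = sphere_dist x y.

(* Balls of rational center and radius for the sup norm: a countable base. *)
Definition box (q : 'rV[rat]_m.+1 * rat) : set S :=
  [set x | forall j, `|ratr (q.1 ord0 j) - sphere_val x ord0 j| < ratr q.2].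

Lemma box_open q : open (box q).
Proof.
exists [set v : 'rV[R]_m.+1 | forall j, 
  `|ratr (q.1 ord0 j) - v ord0 j| < ratr q.2] => //.
rewrite openE => v /= hv.
suff : forall j, nbhs v [set w : 'rV[R]_m.+1 |
    `|ratr (q.1 ord0 j) - w ord0 j| < ratr q.2].
  exact: (@filter_forall _ _ (fun j => [set w : 'rV[R]_m.+1 |
    `|ratr (q.1 ord0 j) - w ord0 j| < ratr q.2]) _ (nbhs_filter v)).
move=> j.
have e0 : 0 < ratr q.2 - `|ratr (q.1 ord0 j) - v ord0 j| by rewrite subr_gt0.
apply/nbhs_ballP; exists (ratr q.2 - `|ratr (q.1 ord0 j) - v ord0 j|) => //.
move=> w [_ /(_ ord0 j)]; rewrite /ball /= ltrBrDl.
exact/le_lt_trans/ler_distD.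
Qed.

Lemma box_nbhs (x : S) (A : set S) : nbhs x A ->
  exists q, box q x /\ box q `<=` A.
Proof.
rewrite nbhsE => -[U [[V oV VU] Ux] UA].
have : nbhs (sphere_val x) V by apply: open_nbhs_nbhs; split=> //;
  rewrite -VU in Ux.
move=> /nbhs_ballP [e /= e0 eV].
have e20 : 0 < e / 2 by rewrite divr_gt0.
have [r /itvP hr] := rat_in_itvoo e20.
have r0 : 0 < ratr r :> R by rewrite hr.
have hq j : exists q : rat, `|ratr q - sphere_val x ord0 j| < ratr r :> R.
  have lt : sphere_val x ord0 j - ratr r < sphere_val x ord0 j + ratr r.
    by rewrite ltrD2l gtrN.
  have [q /itvP hq] := rat_in_itvoo lt.
  by exists q; rewrite ltr_distl hq hq.
have [f hf] := choice hq.
exists (\row_j f j, r); split; first by move=> j /=; rewrite mxE.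
move=> y hy; apply: UA; rewrite -VU /=; apply: eV; split=> // i j.
rewrite (ord1 i) /ball /=.
have := hy j; rewrite /= mxE => h1; have := hf j => h2.
rewrite (le_lt_trans (ler_distD (ratr (f j)) _ _)) // [e]splitr ltrD //.
  by rewrite distrC (lt_trans h2) ?hr.
by rewrite (lt_trans h1) ?hr.
Qed.

Lemma measurable_sphere2E :
  (measurable : set (set (S * S))) = <<s @open (S * S)%type >>.
Proof.
apply/seteqP; split.
  rewrite measurable_prod_measurableType.
  pose B := g_sigma_algebraType (@open (S * S)%type).
  have m1 : measurable_fun setT (fst : B -> S).
    apply: (@measurability _ _ B S setT fst (@open S)) => // _ [A oA <-].
    apply: sub_sigma_algebra; rewrite setTI; apply: open_comp => // z _.
    exact: cvg_fst.
  have m2 : measurable_fun setT (snd : B -> S).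
    apply: (@measurability _ _ B S setT snd (@open S)) => // _ [A oA <-].
    apply: sub_sigma_algebra; rewrite setTI; apply: open_comp => // z _.
    exact: cvg_snd.
  apply: smallest_sub; first exact: smallest_sigma_algebra.
  move=> _ [A mA] [C mC] <-.
  have -> : A `*` C = ([set: B] `&` fst @^-1` A) `&` ([set: B] `&` snd @^-1` C).
    by rewrite !setTI.
  apply: (@measurableI _ B); [exact: m1|exact: m2].
apply: smallest_sub; first exact: (@sigma_algebra_measurable _ (S * S)%type).
move=> U oU.
pose I := (('rV[rat]_m.+1 * rat) * ('rV[rat]_m.+1 * rat))%type.
pose D : set I := [set i : I | box i.1 `*` box i.2 `<=` U].
have -> : U = \bigcup_(i in D) (box i.1 `*` box i.2).
  apply/seteqP; split; last by move=> z [i /= iU zi]; exact: iU.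
  case=> x y Uxy.
  have [/= [A C] [nA nC] ACU] : nbhs (x, y) U by exact: open_nbhs_nbhs.
  have [q [qx qA]] := box_nbhs nA; have [r [ry rC]] := box_nbhs nC.
  exists (q, r) => //= -[x' y'] /= [hx hy].
  by apply: ACU; split; [exact: qA|exact: rC].
rewrite -(setTI D) bigcup_mkcondr.
apply: countable_bigcupT_measurable; first exact: countableP.
move=> i; case: ifP => _; last exact: measurable0.
by apply: measurableX; apply: sub_sigma_algebra; exact: box_open.
Qed.

(* [S * S] carries the product sigma-algebra; by
   [measurable_sphere2E] it is the Borel sigma-algebra of the product. *)
Definition coupling (mu nu : probability S R) :
    set (probability (S * S)%type R) :=
  [set pi | (forall A : set S, measurable A -> pi (A `*` setT) = mu A) /\
            (forall B : set S, measurable B -> pi (setT `*` B) = nu B)].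

Definition Wasserstein (p : R) (mu nu : probability S R) : \bar R :=
  (ereal_inf [set \int[pi]_z (sphere_dist z.1 z.2 `^ p)%:E
               | pi in coupling mu nu]
     `^ p^-1)%E.

(* Library measures are functions on all subsets, with arbitrary values on
   nonmeasurable ones; equality of Borel measures is equality on Borel sets. *)
Definition eq_borel (mu nu : set S -> \bar R) : Prop :=
  forall A : set S, measurable A -> mu A = nu A.

End sphere.

(* Main.v *)
(* The Dirac masses at two antipodal points are at Wasserstein distance 1, the
   diameter of the sphere.  Conversely, if mu and nu are at distance 1, then
   every coupling of them, in particular the product, is concentrated on
   antipodal pairs, so nu is a Dirac mass.  Hence phi maps Dirac masses to Dirac
   masses, and the induced point map is isometric because the Wasserstein
   distance between Dirac masses is the distance between the points. *)
Require Import Defs.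
From mathcomp Require Import all_boot all_order all_algebra.
From mathcomp Require Import all_classical all_reals all_analysis.
From mathcomp Require Import measurable_realfun ring lra.

Import Order.TTheory GRing.Theory Num.Theory.
Import numFieldNormedType.Exports.
Local Open Scope classical_set_scope.
Local Open Scope ring_scope.

(** * Euclidean geometry of the sphere of radius 1/2 *)

Section sphere_geometry.
Context {R : realType} {m : nat}.
Implicit Types x y : sphere R m.

Lemma enorm_eq0 k (v : 'rV[R]_k) : enorm v = 0 -> v = 0.
Proof.
move/eqP; rewrite sqrtr_eq0 => v0; apply/rowP => i; rewrite mxE.
have /psumr_eq0P : \sum_j v ord0 j ^+ 2 = 0.
  by apply/le_anti; rewrite v0 sumr_ge0// => j _; rewrite sqr_ge0.
by move=> /(_ (fun j _ => sqr_ge0 _)) /(_ i isT) /eqP; rewrite sqrf_eq0 => /eqP.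
Qed.

Lemma enorm0 k : enorm (0 : 'rV[R]_k) = 0.
Proof. by rewrite /enorm big1 ?sqrtr0// => i _; rewrite mxE expr0n. Qed.

Lemma enorm_sqr k (v : 'rV[R]_k) : enorm v ^+ 2 = \sum_i v ord0 i ^+ 2.
Proof. by rewrite sqr_sqrtr// sumr_ge0// => i _; rewrite sqr_ge0. Qed.

Lemma enorm_parallelogram k (u v : 'rV[R]_k) :
  enorm (u - v) ^+ 2 + enorm (u + v) ^+ 2 = 2 * enorm u ^+ 2 + 2 * enorm v ^+ 2.
Proof.
rewrite !enorm_sqr !mulr_sumr -!big_split/=; apply: eq_bigr => i _.
by rewrite !mxE; ring.
Qed.

Lemma enorm_sphere_val x : enorm (sphere_val x) = 2^-1.
Proof. by have := set_valP x. Qed.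

(** Parallelogram law with both norms equal to 1/2. It gives at once the diameter bound 1 and its
    equality case, a vanishing sum of the two vectors. *)
Lemma sphere_dist_sqr x y :
  sphere_dist x y ^+ 2 = 1 - enorm (sphere_val x + sphere_val y) ^+ 2.
Proof.
have := enorm_parallelogram _ (sphere_val x) (sphere_val y).
by rewrite !enorm_sphere_val /sphere_dist; lra.
Qed.

Lemma sphere_dist_ge0 x y : 0 <= sphere_dist x y.
Proof. exact: sqrtr_ge0. Qed.

Lemma sphere_dist_le1 x y : sphere_dist x y <= 1.
Proof.
rewrite -(@ler_pXn2r _ 2)// ?nnegrE ?sphere_dist_ge0//.
by rewrite sphere_dist_sqr expr1n gerBl sqr_ge0.
Qed.

Lemma sphere_distxx x : sphere_dist x x = 0.
Proof. by rewrite /sphere_dist subrr enorm0. Qed.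

Lemma sphere_dist_eq0 x y : sphere_dist x y = 0 -> x = y.
Proof. by move/enorm_eq0/subr0_eq/val_inj. Qed.

Lemma sphere_dist_eq1 x y :
  sphere_dist x y = 1 -> sphere_val y = - sphere_val x.
Proof.
move=> d1; apply/eqP; rewrite -addr_eq0 addrC; apply/eqP/enorm_eq0/eqP.
have := sphere_dist_sqr x y; rewrite d1 expr1n -sqrf_eq0.
by move=> h; apply/eqP; lra.
Qed.

Lemma sphere_dist_eq1_inj x y y' :
  sphere_dist x y = 1 -> sphere_dist x y' = 1 -> y = y'.
Proof.
move=> /sphere_dist_eq1 xy /sphere_dist_eq1 xy'; apply: val_inj.
by rewrite /= [LHS]xy.
Qed.

Lemma sphere_antipode x : exists y, sphere_dist y x = 1.
Proof.
have hx : - sphere_val x \in half_sphere R m.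
  rewrite inE /half_sphere /= -(enorm_sphere_val x) /enorm.
  by under eq_bigr do rewrite mxE sqrrN.
exists (SigSub hx); apply/eqP; rewrite -(@eqrXn2 _ 2)// ?sphere_dist_ge0//.
by rewrite sphere_dist_sqr /= addNr enorm0 expr0n subr0 expr1n.
Qed.

End sphere_geometry.

(** * Borel measurability of the distance and of singletons *)

Section sphere_measurability.
Context {R : realType} {m : nat}.
Local Notation S := (sphere R m).

(** Open intervals generate the Borel sets of the line, and their preimages are traces on the sphere
    of open sets of the ambient space. *)
Lemma measurable_sphere_coord j :
  measurable_fun setT (fun x : S => sphere_val x ord0 j).
Proof.
apply: (measurability _ (RGenOpens.measurableE R)).
move=> _ [_ [a [b ->]] <-]; rewrite setTI; apply: sub_sigma_algebra.
exists [set v : 'rV[R]_m.+1 | v ord0 j \in `]a, b[] => //.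
apply: (@open_comp _ R (fun v : 'rV[R]_m.+1 => v ord0 j) [set` `]a, b[]).
  by move=> v _; exact: coord_continuous.
exact: interval_open.
Qed.

Lemma measurable_sphere_dist :
  measurable_fun setT (fun z : S * S => sphere_dist z.1 z.2).
Proof.
rewrite /sphere_dist /enorm; apply: (measurableT_comp (f := @Num.sqrt R)).
  by apply: continuous_measurable_fun; exact: sqrt_continuous.
apply: measurable_sum => j; apply: measurable_funX.
under eq_fun do rewrite !mxE.
apply: measurable_funB.
  by apply: (measurableT_comp (measurable_sphere_coord j)); exact: measurable_fst.
by apply: (measurableT_comp (measurable_sphere_coord j)); exact: measurable_snd.
Qed.

(** A singleton is the zero set of the distance to its point, a section of the jointly measurable
    distance. *)
Lemma measurable_sphere_set1 (x : S) : measurable [set x].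
Proof.
have md := measurable_fun_pair2 x measurable_sphere_dist.
suff -> : [set x] = setT `&` (fun y => sphere_dist x y) @^-1` [set 0].
  by apply: md => //; exact: measurable_set1.
rewrite setTI; apply/seteqP; split => [_ ->|y /= /sphere_dist_eq0 ->//].
exact: sphere_distxx.
Qed.

End sphere_measurability.

(** * Almost-everywhere statements for a probability measure *)

Section probability_lemmas.
Context {d : measure_display} {T : measurableType d} {R : realType}.
Variable P : probability T R.

(** Were [Q] to fail everywhere, the exceptional null set would be the whole space, of mass 1. *)
Lemma probability_ae_ex (Q : T -> Prop) :
  {ae P, forall x, Q x} -> exists x, Q x.
Proof.
move=> [N [mN PN0 QN]]; apply: contrapT => /forallNP nQ.
have NT : N = setT by apply/seteqP; split => // x _; exact/QN/nQ.
by move: PN0 (probability_setT P); rewrite NT => -> /esym/eqP; rewrite onee_eq0.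
Qed.

Lemma ae_eq_cst_dirac (y : T) (A : set T) :
  {ae P, forall x, x = y} -> measurable A -> P A = \d_y A.
Proof.
move=> [N [mN PN0 yN]] mA.
(* A set missing [y] lies in the exceptional null set; this is applied to [A] or to its complement,
   whichever misses [y]. *)
have P0 B : measurable B -> ~ B y -> P B = 0%E.
  move=> mB By; apply: (subset_measure0 mB mN _ PN0) => x Bx.
  by apply: yN => /= xy; apply: By; rewrite -xy.
rewrite diracE; case: (boolP (y \in A)) => [/set_mem|/negP] yA /=.
  have mCA := measurableC mA.
  by rewrite -[in LHS](setCK A) probability_setC// P0 ?sube0//; exact.
by rewrite P0// => /mem_set.
Qed.

Lemma ge0_integral_eq0_ae (f : T -> \bar R) :
  measurable_fun setT f -> (forall x, (0 <= f x)%E) -> (\int[P]_x f x = 0)%E ->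
  {ae P, forall x, f x = 0%E}.
Proof.
move=> mf f0 If0.
have : (\int[P]_x `|f x| = 0)%E by under eq_integral do rewrite gee0_abs//.
move=> /(ae_eq_integral_abs P measurableT mf) [N [mN PN0 sN]].
exists N; split => // x /= fx.
by apply: sN => /= h; apply: fx; exact: h.
Qed.

End probability_lemmas.

(** * Wasserstein distances of Dirac masses, and the case of distance 1 *)

Section Wasserstein_distance.
Context {R : realType} {m : nat} {p : R} (p0 : 0 < p).
Local Notation S := (sphere R m).
Implicit Types mu nu : probability S R.

Let measurable_cost :
  measurable_fun setT (fun z : S * S => sphere_dist z.1 z.2 `^ p).
Proof.
exact: measurableT_comp (measurable_powR p) measurable_sphere_dist.
Qed.

Let cost_le1 (x y : S) : sphere_dist x y `^ p <= 1.
Proof.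
apply: (@le_trans _ _ (1 `^ p)); last by rewrite powR1.
by apply: ge0_ler_powR; rewrite ?nnegrE ?sphere_dist_ge0 ?sphere_dist_le1 ?ltW.
Qed.

Let cost_eq1 (x y : S) : sphere_dist x y `^ p = 1 -> sphere_dist x y = 1.
Proof.
move=> h; rewrite -[LHS](powRr1 (sphere_dist_ge0 x y)).
by rewrite -[X in _ `^ X](mulfV (lt0r_neq0 p0)) powRrM h powR1.
Qed.

(** The complement of [(x, y)] is covered by two strips, one for each wrong coordinate, and each
    marginal makes one strip null. *)
Lemma coupling_dirac mu nu x y (pi : probability (S * S)%type R) :
  eq_borel mu \d_x -> eq_borel nu \d_y -> coupling mu nu pi ->
  {ae pi, forall z, z = (x, y)}.
Proof.
move=> mux nuy [pi1 pi2].
have mC (z : S) : measurable (~` [set z]).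
  exact: measurableC (measurable_sphere_set1 z).
exists (~` [set x] `*` setT `|` setT `*` ~` [set y]); split.
- by apply: measurableU; apply: measurableX => //; exact: mC.
- apply/eqP; rewrite eq_le measure_ge0 andbT.
  apply: le_trans (measureU2 _ _ _) _; first exact: measurableX (mC _) _.
    exact: measurableX _ (mC _).
  rewrite [X in (X + _)%E]pi1// [X in (_ + X)%E]pi2// mux// nuy// !diracE.
  by rewrite !memNset ?adde0//=; exact.
- move=> [x' y'] /= neq; apply: contrapT => /not_orP [/= h1 h2]; apply: neq.
  have -> : x' = x by apply: contrapT => ?; apply: h1.
  by have -> : y' = y by apply: contrapT => ?; apply: h2.
Qed.

Lemma Wasserstein_dirac mu nu x y :
  eq_borel mu \d_x -> eq_borel nu \d_y ->
  Wasserstein p mu nu = (sphere_dist x y)%:E.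
Proof.
move=> mux nuy; rewrite /Wasserstein.
(* All couplings have the same cost, so the infimum is over a single value. *)
suff -> : [set (\int[pi]_z (sphere_dist z.1 z.2 `^ p)%:E)%E
          | pi in coupling mu nu] = [set (sphere_dist x y `^ p)%:E].
  rewrite ereal_inf1 poweR_EFin -powRrM mulfV ?lt0r_neq0//.
  by rewrite powRr1// sphere_dist_ge0.
have I pi : coupling mu nu pi ->
    (\int[pi]_z (sphere_dist z.1 z.2 `^ p)%:E)%E = (sphere_dist x y `^ p)%:E.
  move=> cpi.
  rewrite (@ae_eq_integral _ _ _ _ _ (cst (sphere_dist x y `^ p)%:E))//.
  - by rewrite integral_cst// [X in (_ * X)%E]probability_setT mule1.
  - exact/measurable_EFinP.
  - have [N [mN N0 sN]] := coupling_dirac _ _ _ _ _ mux nuy cpi.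
    exists N; split => // z /= h; apply: sN => /= zxy; apply: h => _.
    by rewrite zxy.
apply/seteqP; split => [_ [pi cpi <-]|_ ->]; first exact: I.
(* The set of costs is nonempty, since the Dirac mass at the pair is a coupling. *)
have c : coupling mu nu \d_(x, y).
  split => A mA /=.
    by rewrite mux// /dirac/= !indicE in_setX/= in_setT andbT.
  by rewrite nuy// /dirac/= !indicE in_setX/= in_setT.
by exists \d_(x, y) => //; exact: I.
Qed.

Lemma product_coupling mu nu : coupling mu nu (mu \x nu)%E.
Proof.
split => A mA /=; rewrite product_measure1E//.
  by rewrite [X in (_ * X)%E]probability_setT mule1.
by rewrite [X in (X * _)%E]probability_setT mul1e.
Qed.

(* The cost is at most 1, so an optimal value of 1 forces it to equal 1 almost
   everywhere for the product coupling; by Tonelli some section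
   [{y | d(x, y) = 1}], which is a single antipode, carries all of [nu]. *)
Lemma Wasserstein_eq1_dirac mu nu :
  Wasserstein p mu nu = 1%E -> exists y, eq_borel nu \d_y.
Proof.
move=> W1.
pose c (z : S * S) := sphere_dist z.1 z.2 `^ p.
pose f (z : S * S) := (1 - c z)%:E.
have mf : measurable_fun setT f.
  by apply/measurable_EFinP; exact: measurable_funB.
have f0 z : (0 <= f z)%E by rewrite lee_fin subr_ge0 cost_le1.
(* Nonnegativity allows the outer exponent to be undone: the infimum [I] equals the [p]-th power of
   its [1/p]-th power. *)
have inf_ge0 :
    (0 <= ereal_inf [set \int[pi]_z (c z)%:E | pi in coupling mu nu])%E.
  apply: le_ereal_inf_tmp => _ [pi _ <-].
  by apply: integral_ge0 => z _; rewrite lee_fin powR_ge0.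
have inf1 : (ereal_inf [set \int[pi]_z (c z)%:E | pi in coupling mu nu] = 1)%E.
  rewrite -[LHS]poweRe1// -[X in (_ `^ X)%E](mulVf (lt0r_neq0 p0)) poweRrM.
  by rewrite -[X in (X `^ p)%E]/(Wasserstein p mu nu) W1 poweR1r.
have c1 : (1 <= \int[mu \x nu]_z (c z)%:E)%E.
  rewrite -inf1; apply: ereal_inf_lbound.
  by exists (mu \x nu)%E => //; exact: product_coupling.
have If0 : (\int[mu \x nu]_z f z = 0)%E.
  (* The deficit [f] and the cost add up to 1 pointwise, hence in integral. As the cost integral is
     at least 1 and the deficit integral is nonnegative, the latter is 0; the same relations exclude
     infinite values. *)
  have : (\int[mu \x nu]_z f z + \int[mu \x nu]_z (c z)%:E = 1)%E.
    rewrite -ge0_integralD//; last 2 first.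
      by move=> z _; rewrite lee_fin powR_ge0.
      exact/measurable_EFinP.
    under eq_integral do rewrite -EFinD subrK.
    by rewrite integral_cst//= probability_setT mule1.
  have : (0 <= \int[mu \x nu]_z f z)%E by exact: integral_ge0.
  move: c1; case: (\int[mu \x nu]_z (c z)%:E)%E => [r| |]//;
    case: (\int[mu \x nu]_z f z)%E => [s| |]//.
  by rewrite !lee_fin => r1 s0 [sr]; congr EFin; lra.
have [x /= fx] : exists x, fubini_F nu f x = 0%E.
  apply: (probability_ae_ex mu); apply: ge0_integral_eq0_ae.
  - exact: measurable_fun_fubini_tonelli_F.
  - by move=> x; exact: integral_ge0.
  - by rewrite -fubini_tonelli1.
have fx0 : {ae nu, forall y, f (x, y) = 0%E}.
  by apply: ge0_integral_eq0_ae fx; [exact: measurable_fun_pair2|move=> y].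
have dist1 y : f (x, y) = 0%E -> sphere_dist x y = 1.
  by move=> [fxy]; apply: cost_eq1; rewrite /c/= in fxy; lra.
have [y /dist1 xy] := probability_ae_ex _ _ fx0.
exists y => A mA; apply: ae_eq_cst_dirac mA.
have [N [mN N0 sN]] := fx0; exists N; split => // z /= zy; apply: sN => /= fxz.
by apply: zy; apply: sphere_dist_eq1_inj xy; exact: dist1.
Qed.

End Wasserstein_distance.

Theorem theorem14 (R : realType) (n : nat) (hn : (2 <= n)%N)
    (p : R) (hp : 1 <= p)
    (phi : probability (sphere R n.-1) R -> probability (sphere R n.-1) R)
    (hphi : forall mu nu : probability (sphere R n.-1) R,
      Wasserstein p (phi mu) (phi nu) = Wasserstein p mu nu) :
  exists T : sphere R n.-1 -> sphere R n.-1, sphere_isometry T /\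
    forall x : sphere R n.-1,
      eq_borel (phi \d_x) (pushforward \d_x T) /\
      eq_borel (phi \d_x) \d_(T x).
Proof.
have p0 : 0 < p by exact: lt_le_trans hp.
have phi_dirac x : exists y, eq_borel (phi \d_x) \d_y.
  have [y yx] := sphere_antipode x.
  (* The image of the antipodal Dirac mass is a partner at distance 1 from [phi \d_x]. *)
  apply: (Wasserstein_eq1_dirac p0 (phi \d_y)).
  by rewrite hphi (Wasserstein_dirac p0 _ _ y x)// yx.
have [T hT] := choice phi_dirac.
exists T; split => [x y|x].
  apply: EFin_inj; rewrite -(Wasserstein_dirac p0 _ _ _ _ (hT x) (hT y)) hphi.
  exact: Wasserstein_dirac.
(* [pushforward \d_x T] and [\d_(T x)] agree by computation, so both claims reduce to [hT x]. *)
by split => // A mA; rewrite hT.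
Qed.
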